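(* Let $p$ be a homogeneous polynomial on $\mathbb{R}^n$ that is hyperbolic with respect to $e\in\mathbb{R}^n$, and let $\mathcal{F}$ be a face of $\Lambda_+(p,e)$. Let $z$ be a point of the relative interior of $\mathcal{F}$ and let $m=\operatorname{mult}_p(z)$. Then $z\in\operatorname{int}(\Lambda_+^{(m)})$ and $$\mathcal{F}=\operatorname{span}(\mathcal{F})\cap\Lambda_+^{(m)}.$$
   Context: A homogeneous polynomial $p$ of degree $d$ in $n$ real variables is hyperbolic with respect to $e\in\mathbb{R}^n$ if $p(e)>0$ and, for each $x\in\mathbb{R}^n$, the univariate polynomial $t\mapsto p(te-x)$ has only real zeros. Its (closed) hyperbolicity cone is $\Lambda_+(p,e)=\{x\in\mathbb{R}^n : \text{all zeros of } t\mapsto p(te-x) \text{ are nonnegative}\}$, which is a closed convex cone. For $k\ge 0$, $D_e^kp(x)=\frac{d^k}{dt^k}p(x+te)\big|_{t=0}$ is the $k$th directional derivative of $p$ in direction $e$ (with $D_e^0p=p$). For $0\le m\le d-1$, the polynomial $D_e^mp$ is hyperbolic with respect to $e$, and the $m$th derivative relaxation is $\Lambda_+^{(m)}=\Lambda_+(D_e^mp,e)$, equivalently $\Lambda_+^{(m)}=\{x\in\mathbb{R}^n : D_e^kp(x)\ge 0 \text{ for } k=m,m+1,\ldots,d-1\}$; by convention $\Lambda_+^{(d)}=\mathbb{R}^n$. For $x\in\mathbb{R}^n$, $\operatorname{mult}_p(x)$ denotes the multiplicity of $0$ as a zero of $t\mapsto p(te-x)$ (it is $0$ if $p(x)\neq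 0$; it does not depend on the choice of direction of hyperbolicity $e$). A face of a closed convex set $C\subseteq\mathbb{R}^n$ is a closed convex set $\mathcal{F}\subseteq C$ such that whenever $x,y\in C$ satisfy $\alpha x+(1-\alpha)y\in\mathcal{F}$ for some $\alpha\in(0,1)$, then $x,y\in\mathcal{F}$. *)

(* Defs.v *)
From HB Require Import structures.
From mathcomp Require Import all_boot all_order all_algebra.
From mathcomp Require Import all_classical all_reals all_analysis.
From mathcomp Require Import complex.
(* The notations of [mpoly] clash with those of [analysis]. *)
From mathcomp Require Import -(notations) mpoly.

Set Implicit Arguments.
Unset Strict Implicit.
Unset Printing Implicit Defensive.

Import Order.TTheory GRing.Theory Num.Theory.
Import numFieldNormedType.Exports.

Local Open Scope classical_set_scope.
Local Open Scope ring_scope.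

Section Polynomials.
Context {R : realType} {n : nat}.
Implicit Types (p : mpoly n R) (a b e x : 'rV[R]_n) (q : {poly R}).

Definition peval p x : R := meval (x ord0) p.

(* p(a + t b), as a polynomial in t *)
Definition on_line p a b : {poly R} :=
  mmap polyC (fun i => (a ord0 i)%:P + b ord0 i *: 'X) p.

Definition real_rooted q : Prop :=
  forall z : R[i],
    root (map_poly (real_complex R) q) z -> z \is Num.real.

Definition hyperbolic p e : Prop :=
  0 < peval p e /\ forall x, real_rooted (on_line p (- x) e).

(* Only real zeros are tested; when p is hyperbolic with respect to e these are
   all the zeros. *)
Definition hyperbolicity_cone p e : set 'rV[R]_n :=
  [set x | forall t : R, root (on_line p (- x) e) t -> 0 <= t].

(* D_e^k p, as a polynomial in x: expand p(x + t e) in R[x][t], differentiate k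
   times in t and set t = 0. Lemma [peval_dirderiv] is the pointwise version. *)
Definition dirderiv e (k : nat) p : mpoly n R :=
  (mmap (polyC \o mpolyC n (R:=R))
     (fun i => (mpolyX R (mnm1 i))%:P
               + (mpolyC n (e ord0 i)) *: 'X) p)^`(k).[0].

(* d is the degree of p. The case m = d is the convention that the relaxation is
   the whole space; m > d is junk. *)
Definition derivative_relaxation (d m : nat) p e : set 'rV[R]_n :=
  if (m < d)%N then hyperbolicity_cone (dirderiv e m p) e else setT.

Definition pmult p e x : nat := mup 0 (on_line p (- x) e).

Lemma on_lineE p a b (t : R) : (on_line p a b).[t] = peval p (a + t *: b).
Proof.
rewrite /on_line /peval /meval /mmap horner_sum.
apply: eq_bigr => m _; rewrite hornerM hornerC /mmap1 horner_prod.
congr (_ * _); apply: eq_bigr => i _.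
by rewrite horner_exp !hornerE !mxE mulrC.
Qed.

Lemma peval_dirderiv e k p x :
  peval (dirderiv e k p) x = (on_line p x e)^`(k).[0].
Proof.
rewrite /peval /dirderiv.
rewrite -(horner_map (meval (x ord0))) /= rmorph0 -derivn_map.
congr (_^`(k).[0]).
rewrite /on_line /mmap rmorph_sum; apply: eq_bigr => m _.
rewrite rmorphM /= map_polyC /= mevalC; congr (_ * _).
rewrite /mmap1 rmorph_prod; apply: eq_bigr => i _.
rewrite rmorphXn rmorphD /= map_polyC /= mevalXU.
by rewrite map_polyZ /= mevalC map_polyX.
Qed.

End Polynomials.

Section ConvexGeometry.
Context {R : realType} {n : nat}.
Implicit Types (C F S : set 'rV[R]_n) (x y z : 'rV[R]_n).

Definition is_face F C : Prop :=
  [/\ closed F, @convex_set R 'rV[R]_n F, F `<=` C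
    & forall x y (alpha : R), C x -> C y -> 0 < alpha -> alpha < 1 ->
        F (alpha *: x + (1 - alpha) *: y) -> F x /\ F y].

Definition linear_span S : set 'rV[R]_n :=
  [set x | exists (k : nat) (c : 'I_k -> R) (v : 'I_k -> 'rV[R]_n),
     (forall i, S (v i)) /\ x = \sum_(i < k) c i *: v i].

Definition affine_span S : set 'rV[R]_n :=
  [set x | exists (k : nat) (c : 'I_k -> R) (v : 'I_k -> 'rV[R]_n),
     [/\ forall i, S (v i), \sum_(i < k) c i = 1
       & x = \sum_(i < k) c i *: v i]].

Definition relative_interior S : set 'rV[R]_n :=
  [set z | S z /\ \forall y \near z, affine_span S y -> S y].

End ConvexGeometry.

(* Main.v *)
(* Write [f_x t = p (x + t e)]. The multiplicity of [x] is the order of vanishing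
   of [f_x] at 0, and [x] lies in the cone iff [f_x > 0] on the positive
   half-line, in which case all coefficients of [f_x] are nonnegative.

   The key fact is that adding a point of a face cannot increase multiplicity: if [a] and [b] lie in
   a convex cone inside the hyperbolicity cone, then [f_a <= f_(a + b)] on the
   positive half-line. Indeed [p] is hyperbolic with respect to [a + t e] too
   (Garding), and [s |-> p (b + s (a + t e))] then has only nonpositive zeros.
   Splitting the relative interior point [z] as [d x + (z - d x)] shows that the
   coefficients of [f_x] of degree less than [m] vanish for [x] in the face, hence
   on its span. For [x] in the span and in the relaxation, [f_x^(m) > 0] on the
   positive half-line integrates to [f_x > 0], so [x] is in the cone, and therefore
   in the face. At [z] itself the coefficients of [f_z] of degree [m] to [d] are
   positive, which persists near [z]. *)

Require Import Defs.
From HB Require Import structures.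
From mathcomp Require Import all_boot all_order all_algebra.
From mathcomp Require Import all_classical all_reals all_analysis.
From mathcomp Require Import complex.
From mathcomp Require Import -(notations) mpoly.
From mathcomp Require polyrcf.
From mathcomp Require Import ring lra.

Set Implicit Arguments.
Unset Strict Implicit.
Unset Printing Implicit Defensive.

Import Order.TTheory GRing.Theory Num.Theory.
Import numFieldNormedType.Exports.

Local Open Scope classical_set_scope.
Local Open Scope ring_scope.

(** * Restriction of polynomials to lines *)

Section Lines.
Context {R : realType} {n : nat}.
Implicit Types (p : mpoly n R) (S T : comNzRingType).

(** [on_line] over an arbitrary ring [S], so that the coordinates can be complex numbers or
    polynomials in a deformation parameter. *)
Definition linepoly S (f : R -> S) (A B : 'I_n -> S) p : {poly S} :=
  mmap (polyC \o f) (fun i => (A i)%:P + B i *: 'X) p.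

Lemma rmorph_mmap S T (f : R -> S) (g : {rmorphism S -> T}) (h : 'I_n -> S) p :
  g (mmap f h p) = mmap (g \o f) (g \o h) p.
Proof.
rewrite /mmap rmorph_sum; apply: eq_bigr => m _; rewrite rmorphM /mmap1 rmorph_prod.
by congr (_ * _); apply: eq_bigr => i _; rewrite rmorphXn.
Qed.

Lemma eq_mmap S (f g : R -> S) (h k : 'I_n -> S) p :
  f =1 g -> h =1 k -> mmap f h p = mmap g k p.
Proof. by move=> /funext -> /funext ->. Qed.

Lemma mmap_scale S (f : R -> S) (h : 'I_n -> S) d p (c : S) :
  p \is @ishomog1 n R d mdeg ->
  mmap f (fun i => c * h i) p = c ^+ d * mmap f h p.
Proof.
move=> hp; rewrite /mmap mulr_sumr big_seq [RHS]big_seq; apply: eq_bigr => m mp.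
rewrite mulrCA; congr (_ * _).
have <- : mdeg m = d := dhomog_mf hp mp.
rewrite mdegE -prodrXr -big_split /=.
by apply: eq_bigr => i _; rewrite exprMn.
Qed.

Lemma linepoly_horner S (f : R -> S) A B p (s : S) :
  (linepoly f A B p).[s] = mmap f (fun i => A i + s * B i) p.
Proof.
rewrite -/(horner_eval s _) [LHS]rmorph_mmap; apply: eq_mmap => i /=.
  by rewrite /horner_eval hornerC.
by rewrite /horner_eval !hornerE mulrC.
Qed.

Lemma map_linepoly S T (f : R -> S) (g : {rmorphism S -> T}) A B p :
  map_poly g (linepoly f A B p) = linepoly (g \o f) (g \o A) (g \o B) p.
Proof.
rewrite /linepoly [LHS]rmorph_mmap; apply: eq_mmap => i /=.
  by rewrite map_polyC.
by rewrite rmorphD /= map_polyC map_polyZ map_polyX.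
Qed.

Lemma coefM_top S (q1 q2 : {poly S}) k1 k2 :
  (size q1 <= k1.+1)%N -> (size q2 <= k2.+1)%N ->
  (q1 * q2)`_(k1 + k2) = q1`_k1 * q2`_k2.
Proof.
move=> s1 s2; have h : (k1 < (k1 + k2).+1)%N by rewrite ltnS leq_addr.
rewrite coefM (bigD1 (Ordinal h)) //= addKn big1 ?addr0 // => j jk1.
have [lt|ge] := ltnP j k1.
  by rewrite [q2`_ _]nth_default ?mulr0 // (leq_trans s2) // ltn_subRL ltn_add2r.
rewrite nth_default ?mul0r // (leq_trans s1) // ltn_neqAle ge andbT eq_sym.
by apply: contra jk1 => /eqP jE; apply/eqP/val_inj.
Qed.

(** Over a general ring a product of leading coefficients may vanish, so the proof carries a degree
    bound, not necessarily sharp, together with the coefficient at that bound. *)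
Lemma linepoly_top S (f : R -> S) A B d p :
  p \is @ishomog1 n R d mdeg ->
  (size (linepoly f A B p) <= d.+1)%N /\ (linepoly f A B p)`_d = mmap f B p.
Proof.
move=> hp.
pose K (q : {poly S}) k (c : S) := (size q <= k.+1)%N /\ q`_k = c.
have KM q1 k1 c1 q2 k2 c2 : K q1 k1 c1 -> K q2 k2 c2 ->
    K (q1 * q2) (k1 + k2)%N (c1 * c2).
  move=> [s1 <-] [s2 <-]; split; last exact: coefM_top.
  apply: leq_trans (size_polyMleq _ _) _.
  by rewrite -ltnS; case: (size q1 + _)%N (leq_add s1 s2) => // k; rewrite addSn addnS.
have K1 : K 1 0%N 1 by split; rewrite ?size_poly1 // coef1.
have Klin i : K ((A i)%:P + B i *: 'X) 1%N (B i).
  split; last by rewrite coefD coefC coefZ coefX mulr1 add0r.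
  apply: leq_trans (size_polyD _ _) _; rewrite geq_max.
  by rewrite (leq_trans (size_polyC_leq1 _)) // (leq_trans (size_scale_leq _ _)) ?size_polyX.
have Kexp q k c j : K q k c -> K (q ^+ j) (k * j)%N (c ^+ j).
  move=> Kq; elim: j => [|j IH]; first by rewrite muln0.
  by rewrite !exprS mulnS; apply: (KM).
have Kmon m : m \in msupp p ->
   K ((f (mcoeff m p))%:P * \prod_(i < n) ((A i)%:P + B i *: 'X) ^+ (m i)) d
     (f (mcoeff m p) * \prod_(i < n) B i ^+ m i).
  move=> mp; rewrite -[d]add0n; apply: (KM).
    by split; rewrite ?size_polyC_leq1 // coefC.
  have <- : mdeg m = d := dhomog_mf hp mp.
  rewrite mdegE.
  apply: (big_rec3 K) => // i c k q _ Kq; apply: (KM) => //.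
  by have := Kexp _ _ _ (m i) (Klin i); rewrite mul1n.
rewrite -/(K _ d _) /linepoly /mmap big_seq [X in K _ d X]big_seq.
apply: (big_rec2 (fun q c => K q d c)) => [|m c q mp [s <-]].
  by split; rewrite ?size_poly0 // coef0.
have [s' e'] := Kmon m mp; split; last by rewrite coefD e'.
by apply: leq_trans (size_polyD _ _) _; rewrite geq_max s' s.
Qed.

End Lines.

(** * Zeros of complex polynomials *)

Section RootLocation.
Context {R : realType}.
Local Notation C := R[i].
Local Notation "x %:C" := (real_complex R x) : ring_scope.
Implicit Types (q : {poly R}) (P : {poly C}) (s z : C).

Lemma real_rooted_splits q : real_rooted q ->
  exists rs : seq R, q = lead_coef q *: \prod_(r <- rs) ('X - r%:P).
Proof.
move=> rr; have [zs zsE] := closed_field_poly_normal (map_poly (real_complex R) q).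
exists (map (@complex.Re R) zs).
have [->|q0] := eqVneq q 0; first by rewrite lead_coef0 scale0r.
apply: (map_poly_inj (real_complex R)).
rewrite /= map_polyZ -lead_coef_map zsE; congr (_ *: _).
  by rewrite -zsE.
rewrite big_map rmorph_prod big_seq [RHS]big_seq /=; apply: eq_bigr => z zz.
rewrite map_polyXsubC; congr ('X - _%:P); apply/esym/RRe_real/rr.
by rewrite zsE rootZ ?lead_coef_eq0 ?map_poly_eq0 // root_prod_XsubC.
Qed.

Lemma normc_ge_Im z : `|complex.Im z|%:C <= `|z|.
Proof. by rewrite normc_def lecR -sqrtr_sqr ler_wsqrtr // lerDr sqr_ge0. Qed.

(** If all zeros were at distance at least [eta] from [s], the factorization of [P] would give
    |P(s)| >= |lc P| eta^deg. *)
Lemma root_nearby P s (eta : C) : 0 <= eta ->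
  `|P.[s]| < `|lead_coef P| * eta ^+ (size P).-1 ->
  exists2 z, root P z & `|s - z| < eta.
Proof.
move=> eta0; have [zs zsE] := closed_field_poly_normal P.
have [->|P0] := eqVneq P 0.
  by rewrite lead_coef0 horner0 normr0 mul0r ltxx.
have lP : lead_coef P != 0 by rewrite lead_coef_eq0.
have szs : (size P).-1 = size zs.
  by rewrite zsE size_scale ?lead_coef_eq0 // size_prod_XsubC.
move=> small; apply: contrapT => far.
suff : eta ^+ size zs <= `|\prod_(z <- zs) (s - z)|.
  move=> le; move: small; rewrite szs {1}zsE hornerZ normrM horner_prod.
  rewrite ltr_pM2l ?normr_gt0 //.
  under eq_bigr do rewrite hornerXsubC.
  by move/(le_lt_trans le); rewrite ltxx.
have : all (fun z => eta <= `|s - z|) zs.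
  apply/allP => z zz; rewrite real_leNgt ?ger0_real //; apply/negP => lt.
  by apply: far; exists z; rewrite // zsE rootZ // root_prod_XsubC.
elim: zs {zsE szs small} => [|z zs IH] /=; first by rewrite big_nil normr1 expr0.
move=> /andP[h /IH{}IH]; rewrite big_cons normrM exprS.
by apply: ler_pM => //; apply: exprn_ge0.
Qed.

(** On the closed upper half-plane each factor |s - z| is at least a multiple of 1 + |s|. This
    growth rate lets the bound absorb a perturbation of the coefficients uniformly in [s]. *)
Lemma upper_half_lower_bound P : P != 0 ->
  (forall z, root P z -> complex.Im z < 0) ->
  exists2 k : C, 0 < k &
    forall s, 0 <= complex.Im s -> k * (1 + `|s|) ^+ (size P).-1 <= `|P.[s]|.
Proof.
move=> P0 low; have [zs zsE] := closed_field_poly_normal P.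
have lP : lead_coef P != 0 by rewrite lead_coef_eq0.
have szs : (size P).-1 = size zs.
  by rewrite zsE size_scale ?lead_coef_eq0 // size_prod_XsubC.
have {low} : all (fun z => complex.Im z < 0) zs.
  apply/allP => z zz; apply: low.
  by rewrite zsE rootZ // root_prod_XsubC.
suff : all (fun z => complex.Im z < 0) zs -> exists2 k : C, 0 < k &
    forall s, 0 <= complex.Im s ->
      k * (1 + `|s|) ^+ size zs <= `|\prod_(z <- zs) (s - z)|.
  move=> h /h[k k0 hk]; exists (`|lead_coef P| * k) => [|s s0].
    by rewrite mulr_gt0 ?normr_gt0.
  rewrite szs {2}zsE hornerZ normrM horner_prod -mulrA ler_pM2l ?normr_gt0 //.
  by under eq_bigr do rewrite hornerXsubC; apply: hk.
elim: zs {zsE szs} => [|z zs IH] /=.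
  by exists 1 => // s _; rewrite big_nil normr1 expr0 mulr1.
move=> /andP[z0 /IH[k k0 hk]].
pose dl : C := (- complex.Im z)%:C.
have dl0 : 0 < dl by rewrite ltcR oppr_gt0.
(* Then 1 + |s| <= (1 + |z|) + |s - z| <= M |s - z|, because |s - z| >= dl. *)
pose M : C := (1 + `|z|) / dl + 1.
have M0 : 0 < M.
  by rewrite ltr_pwDr // divr_ge0 ?ltW // addr_gt0 // ltr_pwDl.
exists (k / M) => [|s s0]; first by rewrite divr_gt0.
rewrite big_cons normrM exprS.
rewrite -mulrA [M^-1 * _]mulrA mulrCA; apply: ler_pM => //.
- by rewrite mulr_ge0 ?invr_ge0 ?(ltW M0) // addr_ge0.
- by rewrite mulr_ge0 ?(ltW k0) // exprn_ge0 // addr_ge0.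
- rewrite mulrC ler_pdivrMr //.
  have dle : dl <= `|s - z|.
    apply: le_trans (normc_ge_Im _); rewrite lecR.
    apply: le_trans (ler_norm _).
    by case: (s) (z) s0 => [? ?] [? ?] /= s0; lra.
  rewrite mulrDr mulr1.
  have : `|s| <= `|s - z| + `|z| by rewrite -{1}[s](subrK z) ler_normD.
  move=> tri; apply: (@le_trans _ _ ((1 + `|z|) + `|s - z|)).
    by rewrite -addrA lerD2l [leRHS]addrC.
  rewrite lerD2r mulrA ler_pdivlMr // mulrC ler_wpM2r // addr_ge0 //.
- exact: hk.
Qed.

End RootLocation.

(** * Zeros of one-parameter families of complex polynomials *)

Section Deformation.
Context {R : realType}.
Local Notation C := R[i].
Local Notation "x %:C" := (real_complex R x) : ring_scope.
Implicit Types (Q : {poly {poly C}}) (P : {poly C}) (s z : C).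

(** The outer variable of [Q] is the unknown; its coefficients are polynomials in the deformation
    parameter, here set to a real value. *)
Definition specialize Q (r : R) : {poly C} := map_poly (horner_eval r%:C) Q.

(** The predicate and its negation both define open sets, and the real line is connected. *)
Lemma locally_constant_pred (A : R -> Prop) :
  (forall r0, exists2 dl : R, 0 < dl & forall r, `|r - r0| < dl -> A r <-> A r0) ->
  A 0 -> forall r, A r.
Proof.
move=> loc A0 r.
have op (B : set R) : (forall r0, exists2 dl : R, 0 < dl &
    forall r, `|r - r0| < dl -> B r <-> B r0) -> open B.
  move=> locB; rewrite openE => r0 Br0; have [dl dl0 h] := locB r0.
  by apply/nbhs_ballP; exists dl => // y; rewrite /ball /= distrC => /h ->.
have cT : connected [set: R] by apply/connected_intervalP.
suff : [set r | A r] = setT by move=> /seteqP[_ /(_ r)]; apply.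
apply: cT; first by exists 0.
- by exists [set r | A r]; rewrite ?setTI //; apply: op.
- exists [set r | A r]; rewrite ?setTI // -openC; apply: op => r0.
  by have [dl dl0 h] := loc r0; exists dl => // y /h /=; rewrite /setC /= => ->.
Qed.

Lemma horner_lipschitz (P : {poly C}) (w0 : C) :
  exists2 K, 0 <= K & forall w, `|w - w0| <= 1 -> `|P.[w] - P.[w0]| <= K * `|w - w0|.
Proof.
have : root (P - P.[w0]%:P) w0 by rewrite rootE !hornerE subrr.
move=> /factor_theorem[W WE].
have [K hK] := poly_disk_bound W (`|w0| + 1).
exists K => [|w w1].
  by apply: le_trans (hK w0 _) => //; rewrite lerDl.
have -> : P.[w] - P.[w0] = W.[w] * (w - w0).
  by rewrite -[in RHS]hornerXsubC -hornerM -WE !hornerE.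
rewrite normrM ler_wpM2r // hK //.
by rewrite -[w](subrK w0) addrC (le_trans (ler_normD _ _)) // lerD2l.
Qed.

(** Induction along Horner's scheme: each multiplication by [s] costs one power of 1 + |s|, which
    keeps the constant [K] independent of [s]. *)
Lemma horner2_lipschitz Q d (w0 : C) : (size Q <= d.+1)%N ->
  exists2 K, 0 <= K & forall w, `|w - w0| <= 1 -> forall s,
    `|Q.[s%:P].[w] - Q.[s%:P].[w0]| <= K * `|w - w0| * (1 + `|s|) ^+ d.
Proof.
have Q0 k : exists2 K, 0 <= K & forall w, `|w - w0| <= 1 -> forall s,
    `|(0 : {poly {poly C}}).[s%:P].[w] - (0 : {poly {poly C}}).[s%:P].[w0]|
      <= K * `|w - w0| * (1 + `|s|) ^+ k.
  by exists 0 => // w _ s; rewrite !horner0 subrr normr0 !mul0r.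
elim/poly_ind: Q d => [|Q c IH] d; first by move=> _; apply: Q0.
rewrite size_MXaddC; case: ifP => [/andP[/eqP-> /eqP->] _|_].
  by rewrite mul0r add0r polyC0; apply: Q0.
have [Kc Kc0 hc] := horner_lipschitz c w0.
have one s : 1 <= 1 + `|s| by rewrite lerDl.
rewrite ltnS => sQ.
have [K K0 hK] : exists2 K, 0 <= K & forall w, `|w - w0| <= 1 -> forall s,
    `|Q.[s%:P].[w] - Q.[s%:P].[w0]| * `|s| <= K * `|w - w0| * (1 + `|s|) ^+ d.
  case: d sQ => [|d] sQ.
    move: sQ; rewrite leqn0 size_poly_eq0 => /eqP->.
    by exists 0 => // w _ s; rewrite !horner0 subrr normr0 !mul0r.
  have [K K0 hK] := IH d sQ; exists K => // w w1 s.
  rewrite exprSr mulrA; apply: ler_pM => //; first exact: hK.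
  by rewrite lerDr.
exists (K + Kc) => [|w w1 s]; first by rewrite addr_ge0.
rewrite !hornerE.
have -> : Q.[s%:P].[w] * s + c.[w] - (Q.[s%:P].[w0] * s + c.[w0])
   = (Q.[s%:P].[w] - Q.[s%:P].[w0]) * s + (c.[w] - c.[w0]) by ring.
rewrite [(K + Kc) * _]mulrDl [leRHS]mulrDl; apply: le_trans (ler_normD _ _) _; apply: lerD.
  by rewrite normrM hK.
apply: le_trans (hc w w1) _; rewrite ler_peMr ?mulr_ge0 //.
by rewrite exprn_ege1.
Qed.

Lemma specialize_horner Q r s : (specialize Q r).[s] = Q.[s%:P].[r%:C].
Proof.
have -> : s = horner_eval r%:C s%:P by rewrite /horner_eval hornerC.
by rewrite horner_map /horner_eval hornerC.
Qed.

Lemma specialize_near Q d (r0 : R) (eps : C) : (size Q <= d.+1)%N -> 0 < eps ->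
  exists2 dl : R, 0 < dl & forall r, `|r - r0| < dl -> forall s,
    `|(specialize Q r).[s] - (specialize Q r0).[s]| < eps * (1 + `|s|) ^+ d.
Proof.
move=> sQ e0; have [K K0 hK] := horner2_lipschitz r0%:C sQ.
(* [D] is less than 1, within the range of the Lipschitz bound, and K D < eps. *)
pose D := eps / (K + 1 + eps).
have KE : 0 < K + 1 + eps by rewrite addr_gt0 // ltr_pwDr.
have D0 : 0 < D by rewrite divr_gt0.
have DR : (complex.Re D)%:C = D by apply/RRe_real/ger0_real/ltW.
exists (complex.Re D) => [|r rD s]; first by rewrite -ltcR DR.
have rw : `|r%:C - r0%:C| < D.
  by rewrite -rmorphB normc_def /= expr0n addr0 sqrtr_sqr -DR ltcR.
have D1 : D < 1 by rewrite ltr_pdivrMr // mul1r ltrDr ltr_pwDr.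
rewrite !specialize_horner; apply: le_lt_trans (hK _ (ltW (lt_trans rw D1)) s) _.
rewrite ltr_pM2r ?exprn_gt0 ?ltr_pwDl //.
apply: (@le_lt_trans _ _ (K * D)); first by rewrite ler_wpM2l // ltW.
rewrite mulrA ltr_pdivrMr // mulrC ltr_pM2l //.
by rewrite -addrA ltrDl addr_gt0.
Qed.

Section Family.
Variables (Q : {poly {poly C}}) (d : nat) (c : C).
Hypotheses (sQ : (size Q <= d.+1)%N) (Qd : Q`_d = c%:P) (c0 : c != 0).

(** The top coefficient is a nonzero constant in the parameter, so the degree never drops and no
    zero escapes to infinity. *)
Lemma size_specialize r : size (specialize Q r) = d.+1.
Proof.
apply/eqP; rewrite eqn_leq (leq_trans (size_poly _ _)) //= ltnNge.
apply: contra c0 => /leq_sizeP/(_ d (leqnn _)).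
by rewrite coef_map Qd /= /horner_eval hornerC => ->.
Qed.

Lemma lead_coef_specialize r : lead_coef (specialize Q r) = c.
Proof. by rewrite lead_coefE size_specialize coef_map Qd /= /horner_eval hornerC. Qed.

(** The disc around [z0] of radius Im z0 lies in the open upper half-plane. As [z0] is a zero at
    [r0], nearby polynomials are small enough at [z0] to have a zero in that disc. *)
Lemma upper_root_stable r0 z0 : root (specialize Q r0) z0 -> 0 < complex.Im z0 ->
  exists2 dl : R, 0 < dl & forall r, `|r - r0| < dl ->
    exists2 z, root (specialize Q r) z & 0 < complex.Im z.
Proof.
move=> rt im0; pose eta := (complex.Im z0)%:C.
have eta0 : 0 < eta by rewrite ltcR.
have B0 : 0 < (1 + `|z0|) ^+ d by rewrite exprn_gt0 // ltr_pwDl.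
have [|dl dl0 h] := @specialize_near Q d r0 (`|c| * eta ^+ d / (1 + `|z0|) ^+ d) sQ.
  by rewrite divr_gt0 // mulr_gt0 ?normr_gt0 // exprn_gt0.
exists dl => // r /h/(_ z0); rewrite (rootP rt) subr0 divfK ?gt_eqF // => small.
have [||z rz zz] := @root_nearby _ (specialize Q r) z0 eta; first exact: ltW.
  by rewrite lead_coef_specialize size_specialize.
exists z => //; have := le_lt_trans (normc_ge_Im _) zz; rewrite ltcR.
case: (z0) (z) => [? ?] [? ?] /=; rewrite ltr_norml; lra.
Qed.

(** On the closed upper half-plane the perturbation is smaller than the lower bound for the
    unperturbed value, so no zero can enter. *)
Lemma lower_half_stable r0 : (forall z, root (specialize Q r0) z -> complex.Im z < 0) ->
  exists2 dl : R, 0 < dl & forall r, `|r - r0| < dl ->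
    forall z, root (specialize Q r) z -> complex.Im z < 0.
Proof.
move=> low.
have q0 : specialize Q r0 != 0 by rewrite -size_poly_eq0 size_specialize.
have [k k0 hk] := upper_half_lower_bound q0 low.
have [dl dl0 h] := specialize_near r0 sQ k0.
exists dl => // r /h hr z rz; rewrite ltNge; apply/negP => /hk.
rewrite size_specialize => /(lt_le_trans (hr z)).
by rewrite (rootP rz) sub0r normrN ltxx.
Qed.

(* Having all zeros in the lower half-plane is both an open and a closed condition
   on [r], because no zero can be real. *)
Lemma lower_half_deformation :
  (forall r s : R, ~~ root (specialize Q r) s%:C) ->
  (forall z, root (specialize Q 0) z -> complex.Im z < 0) ->
  forall r z, root (specialize Q r) z -> complex.Im z < 0.
Proof.
move=> nz; apply: locally_constant_pred => r0.
have [low|] := pselect (forall z, root (specialize Q r0) z -> complex.Im z < 0).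
  have [dl dl0 h] := lower_half_stable low.
  by exists dl => // r /h hr; split.
move=> up; have [z0 rz0 z00] : exists2 z0, root (specialize Q r0) z0 & 0 < complex.Im z0.
  apply: contrapT => h; apply: up => z rz; rewrite ltNge; apply/negP => z0.
  apply: h; exists z => //; rewrite lt_neqAle z0 andbT; apply/negP => /eqP im0.
  by case: z rz im0 {z0} => a b rz /= b0; move: rz; rewrite -b0; apply/negP/(nz r0 a).
have [dl dl0 h] := upper_root_stable rz0 z00.
exists dl => // r /h[z rz zz]; split=> // low.
by have := low z rz; rewrite ltNge (ltW zz).
Qed.

(** A zero in the open upper half-plane at parameter 0 would persist for small positive
    parameters. *)
Lemma lower_half_limit :
  (forall r, 0 < r -> forall z, root (specialize Q r) z -> complex.Im z < 0) ->
  forall z, root (specialize Q 0) z -> complex.Im z <= 0.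
Proof.
move=> low z rz; rewrite leNgt; apply/negP => z0.
have [dl dl0 h] := upper_root_stable rz z0.
have [|w rw w0] := h (dl / 2).
  by rewrite subr0 ger0_norm ?divr_ge0 ?ltW // ltr_pdivrMr // ltr_pMr // ltr1n.
have := low (dl / 2) (divr_gt0 dl0 (ltr0n _ 2)) w rw.
by rewrite ltNge (ltW w0).
Qed.

End Family.
End Deformation.

(** * Change of the direction of hyperbolicity *)

Section Garding.
Context {R : realType} {n : nat}.
Local Notation C := R[i].
Local Notation "x %:C" := (real_complex R x) : ring_scope.
Local Notation toC := (real_complex R).
Implicit Types (p : mpoly n R) (a b e x y : 'rV[R]_n) (s z : C).

Lemma on_line_linepoly p a b : on_line p a b = linepoly idfun (a ord0) (b ord0) p.
Proof. by []. Qed.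

Lemma size_on_line d p a b : p \is @ishomog1 n R d mdeg ->
  (size (on_line p a b) <= d.+1)%N.
Proof. by move=> hp; have [] := linepoly_top idfun (a ord0) (b ord0) hp. Qed.

Lemma coef_on_line_top d p a b : p \is @ishomog1 n R d mdeg ->
  (on_line p a b)`_d = peval p b.
Proof. by move=> hp; have [] := linepoly_top idfun (a ord0) (b ord0) hp. Qed.

Lemma peval_scale d p (c : R) x : p \is @ishomog1 n R d mdeg ->
  peval p (c *: x) = c ^+ d * peval p x.
Proof.
move=> hp; rewrite -(@mmap_scale _ _ _ _ _ _ _ _ hp).
by apply: eq_mmap => // i; rewrite mxE.
Qed.

Lemma on_lineC_horner p a b z :
  (map_poly toC (on_line p a b)).[z] =
  mmap toC (fun i => (a ord0 i)%:C + z * (b ord0 i)%:C) p.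
Proof. by rewrite on_line_linepoly map_linepoly linepoly_horner. Qed.

Lemma hyperbolic_nonreal p e x z : hyperbolic p e -> complex.Im z != 0 ->
  mmap toC (fun i => (x ord0 i)%:C + z * (e ord0 i)%:C) p != 0.
Proof.
move=> [_ /(_ (- x))]; rewrite opprK => rr; apply: contra => rz.
case: z rz => u v rz /=; rewrite -(complex_real u); apply: rr.
by rewrite rootE on_lineC_horner.
Qed.

(* The zeros in [s] of [p (i al e + r b + s x)] are never real for [al > 0], and lie
   in the lower half-plane for [r = 0], hence also for [r = 1]. Letting [al] go to 0,
   the zeros of the real polynomial [p (b + s x)] have nonpositive imaginary part,
   and they are stable under conjugation. *)
Lemma hyperbolic_direction d p e x : p \is @ishomog1 n R d mdeg ->
  hyperbolic p e -> (forall t : R, 0 <= t -> 0 < peval p (x + t *: e)) ->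
  forall b, real_rooted (on_line p b x).
Proof.
move=> hp hyp pos b.
have px : 0 < peval p x by have := pos 0 (lexx _); rewrite scale0r addr0.
pose xC i := (x ord0 i)%:C; pose eC i := (e ord0 i)%:C; pose bC i := (b ord0 i)%:C.
have px0 : (peval p x)%:C != 0 by rewrite fmorph_eq0 gt_eqF.
have topP A (Q := linepoly (polyC \o toC) A (polyC \o xC) p) :
    (size Q <= d.+1)%N /\ Q`_d = ((peval p x)%:C)%:P.
  have [sQ ->] := linepoly_top (polyC \o toC) A (polyC \o xC) hp; split=> //.
  by rewrite /peval [in RHS]/meval !rmorph_mmap; apply: eq_mmap.
pose Q1 (al : R) := linepoly (polyC \o toC)
  (fun i => ((al *i)%C * eC i)%:P + bC i *: 'X) (polyC \o xC) p.
(* Here the parameter multiplies i e instead of [b], for the passage to the limit al = 0. *)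
pose Q2 := linepoly (polyC \o toC)
  (fun i => (bC i)%:P + ('i%C * eC i) *: 'X) (polyC \o xC) p.
have Q1E al r z : (specialize (Q1 al) r).[z] =
    mmap toC (fun i => (al *i)%C * eC i + r%:C * bC i + z * xC i) p.
  rewrite /specialize map_linepoly linepoly_horner; apply: eq_mmap => i /=.
    by rewrite /horner_eval hornerC.
  by rewrite /horner_eval !hornerE [bC i * _]mulrC.
have Q2E r z : (specialize Q2 r).[z] =
    mmap toC (fun i => (r *i)%C * eC i + bC i + z * xC i) p.
  rewrite /specialize map_linepoly linepoly_horner; apply: eq_mmap => i /=.
    by rewrite /horner_eval hornerC.
  rewrite /horner_eval !hornerE [bC i + _]addrC mulrAC.
  by have -> : 'i%C * r%:C = (r *i)%C :> C by simpc.
have low al r z : 0 < al -> root (specialize (Q1 al) r) z -> complex.Im z < 0.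
  move=> al0; have [sQ Qd] := topP (fun i => ((al *i)%C * eC i)%:P + bC i *: 'X).
  apply: (lower_half_deformation sQ Qd px0) => {r z} [r s|z].
    rewrite rootE Q1E.
    have -> : mmap toC (fun i => (al *i)%C * eC i + r%:C * bC i + s%:C * xC i) p =
      mmap toC (fun i => ((r *: b + s *: x) ord0 i)%:C + (al *i)%C * eC i) p.
      apply: eq_mmap => // i.
      by rewrite !mxE rmorphD !rmorphM /= -addrA addrC.
    by apply: hyperbolic_nonreal hyp _ => /=; rewrite gt_eqF.
  rewrite rootE Q1E.
  have -> : mmap toC (fun i => (al *i)%C * eC i + (0 : R)%:C * bC i + z * xC i) p =
      mmap toC (fun i => z * xC i + (al *i)%C * eC i) p.
    by apply: eq_mmap => // i; rewrite rmorph0 mul0r addr0 addrC.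
  have [->|z0] := eqVneq z 0.
    rewrite (_ : mmap _ _ _ =
      mmap toC (fun i => ((0 : 'rV[R]_n) ord0 i)%:C + (al *i)%C * eC i) p).
      by rewrite (negPf (hyperbolic_nonreal _ hyp _)) //= gt_eqF.
    by apply: eq_mmap => // i; rewrite mxE rmorph0 mul0r.
  (* By homogeneity p(z x + i al e) = z^d p(x + w e). Hyperbolicity makes such a zero [w] real,
     positivity of p(x + t e) for t >= 0 makes it negative, and w z = i al then puts [z] in the
     lower half-plane. *)
  pose w := (al *i)%C / z.
  rewrite (_ : mmap _ _ _ = z ^+ d * mmap toC (fun i => xC i + w * eC i) p); last first.
    rewrite -(mmap_scale _ _ _ hp); apply: eq_mmap => // i.
    by rewrite mulrDr mulrA /w mulrCA divff // mulr1.
  rewrite mulf_eq0 expf_eq0 (negPf z0) andbF /= => rw.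
  have w0 : complex.Im w = 0.
    by apply/eqP; apply: contraLR rw => w0; apply: hyperbolic_nonreal hyp w0.
  have wE : w = (complex.Re w)%:C by case: (w) w0 => ? ? /= ->.
  have wneg : complex.Re w < 0.
    rewrite ltNge; apply/negP => /pos; rewrite lt_neqAle eq_sym => /andP[/negP h _].
    apply: h; rewrite -(fmorph_eq0 toC) -(eqP rw) /peval [in X in X == _]/meval rmorph_mmap.
    by apply/eqP; apply: eq_mmap => // i; rewrite /= !mxE rmorphD rmorphM /= -wE.
  have : w * z = (al *i)%C by rewrite /w divfK.
  rewrite wE; case: (z) => u v; simpc => -[_ h] /=; nra.
move=> z; rewrite rootE => rz.
have half z' : (map_poly toC (on_line p b x)).[z'] == 0 -> complex.Im z' <= 0.
  move=> rz'.
  have [sQ Qd] := topP (fun i => (bC i)%:P + ('i%C * eC i) *: 'X).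
  apply: (lower_half_limit sQ Qd px0) => [r r0 w|].
    rewrite rootE Q2E => rw; apply: (low r 1 w r0).
    move: rw; rewrite rootE Q1E; congr (_ == 0).
    by apply: eq_mmap => // i; rewrite mul1r.
  rewrite rootE Q2E; move: rz'; rewrite on_lineC_horner.
  by congr (_ == 0); apply: eq_mmap => // i; rewrite mul0r add0r.
have im1 := half _ rz.
have : complex.Im (conjc z) <= 0.
  apply: half; rewrite -rootE -complex_root_conj -map_poly_comp rootE.
  rewrite (_ : map_poly _ _ = map_poly toC (on_line p b x)) //.
  by apply: eq_map_poly => u /=; rewrite oppr0.
case: z im1 {rz} => u v /= h1 h2; rewrite complex_real eq_le h1 /=; lra.
Qed.

End Garding.

(** * Real univariate polynomials *)

Section Univariate.
Context {R : realType}.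
Implicit Types (f g q : {poly R}).

(** A factor X - r with r <= 0 replaces q_i by q_(i-1) + |r| q_i, so nothing cancels: nonnegativity
    survives, and the indices of positive coefficients stay closed upwards as far as the degree. *)
Lemma prod_nonpos_roots_coef (rs : seq R) (q := \prod_(r <- rs) ('X - r%:P)) :
  all (fun r => r <= 0) rs ->
  (forall i, 0 <= q`_i) /\
  (forall i j, (i <= j <= size rs)%N -> 0 < q`_i -> 0 < q`_j).
Proof.
rewrite /q; elim: rs {q} => [|r rs IH] /=.
  move=> _; rewrite big_nil; split=> [i|i j]; first by rewrite coef1 ler0n.
  by rewrite leqn0 => /andP[ij /eqP j0]; move: ij; rewrite j0 leqn0 => /eqP->.
move=> /andP[r0 /IH[nn up]]; rewrite big_cons.
set q := \prod_(_ <- rs) _ in nn up *.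
have qd : q`_(size rs) = 1.
  have : q \is monic by apply: monic_prod_XsubC.
  by move/monicP; rewrite lead_coefE size_prod_XsubC.
have cE i : (('X - r%:P) * q)`_i = (if i is i'.+1 then q`_i' else 0) - r * q`_i.
  by rewrite mulrBl coefB coefXM coefCM; case: i.
have rq i : 0 <= - r * q`_i by rewrite mulr_ge0 // oppr_ge0.
split=> [i|i j /andP[ij js]].
  by rewrite cE -mulNr addr_ge0 //; case: i.
rewrite !cE -!mulNr => pos.
case: j ij js => [|j] ij js; first by move: ij pos; rewrite leqn0 => /eqP->.
rewrite ltnS in js.
have [qj|] := ltP 0 q`_j; first by rewrite ltr_pwDl.
rewrite le_eqVlt ltNge nn orbF => /eqP qj0; rewrite qj0 add0r.
case: (leqP (size rs) j) => [sj|sj].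
  have jE : j = size rs by apply/eqP; rewrite eqn_leq js sj.
  by move: qj0; rewrite jE qd => /eqP; rewrite oner_eq0.
(* A vanishing q_j below the degree forces all lower coefficients to vanish, which leaves only the
   case i = j + 1. *)
have qi k : (k <= j)%N -> q`_k = 0.
  move=> kj; apply/eqP; rewrite eq_le nn andbT leNgt; apply/negP => qk.
  have kjs : (k <= j <= size rs)%N by rewrite kj ltnW.
  by have := up k j kjs qk; rewrite qj0 ltxx.
move: pos; case: i ij => [|i] ij; first by rewrite qi // mulr0 addr0 ltxx.
move: ij; rewrite leq_eqVlt => /orP[/eqP[->]|]; first by rewrite qj0 add0r.
by rewrite ltnS => ij; rewrite (qi i (ltnW ij)) qi // mulr0 addr0 ltxx.
Qed.

Lemma lead_coef_bounded q k : (size q <= k.+1)%N -> q`_k != 0 ->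
  size q = k.+1 /\ lead_coef q = q`_k.
Proof.
move=> sq qk; have sE : size q = k.+1.
  apply/eqP; rewrite eqn_leq sq ltnNge; apply: contra qk => /leq_sizeP/(_ k (leqnn _)) ->.
  by [].
by rewrite lead_coefE sE.
Qed.

Lemma pos_on_halfline q : 0 < lead_coef q -> (forall t, 0 < t -> q.[t] != 0) ->
  forall t, 0 < t -> 0 < q.[t].
Proof.
move=> lc nz t t0; rewrite ltNge; apply/negP => qt.
have [M hM] := polyrcf.poly_pinfty_gt_lc lc.
pose b := Num.max t M.
have tb : t <= b by rewrite le_max lexx.
have qb : 0 < q.[b] by apply: lt_le_trans lc (hM _ _); rewrite le_max lexx orbT.
have [c] := @polyrcf.poly_ivt _ q t b tb (mulr_le0_ge0 qt (ltW qb)).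
rewrite in_itv /= => /andP[tc _]; apply/negP; apply: nz.
exact: lt_le_trans t0 tc.
Qed.

Lemma zero_at_infinity q (M : R) : (forall t, M <= t -> q.[t] = 0) -> q = 0.
Proof.
move=> z; apply/eqP; apply/negPn/negP => q0.
have wl g : 0 < lead_coef g -> (forall t, M <= t -> g.[t] = 0) -> False.
  move=> lc zg; have [N hN] := polyrcf.poly_pinfty_gt_lc lc.
  have := hN (Num.max M N); rewrite le_max lexx orbT => /(_ isT).
  by rewrite zg ?le_max ?lexx // leNgt lc.
have : lead_coef q != 0 by rewrite lead_coef_eq0.
rewrite neq_lt => /orP[lc|lc]; last exact: wl lc z.
apply: (wl (- q)); first by rewrite lead_coefN oppr_gt0.
by move=> t /z qt; rewrite hornerN qt oppr0.
Qed.

Lemma pos_of_deriv_pos q : 0 <= q.[0] -> (forall t, 0 < t -> 0 < q^`().[t]) ->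
  forall t, 0 < t -> 0 < q.[t].
Proof.
move=> q0 dq t t0; have [c] := polyrcf.poly_mvt q t0.
rewrite in_itv /= subr0 => /andP[c0 _] /eqP; rewrite subr_eq => /eqP->.
by rewrite ltr_pwDl // mulr_gt0 // dq.
Qed.

(** The vanishing coefficients say that the derivatives of order below [m] vanish at 0, so
    positivity of the m-th derivative integrates [m] times. *)
Lemma pos_of_derivn_pos q m : (forall j, (j < m)%N -> q`_j = 0) ->
  (forall t, 0 < t -> 0 < q^`(m).[t]) -> forall t, 0 < t -> 0 < q.[t].
Proof.
elim: m q => [|m IH] q z pos; first by move=> t /pos; rewrite derivn0.
apply: pos_of_deriv_pos; first by rewrite horner_coef0 z.
apply: IH => [j jm|t /pos]; last by rewrite -derivSn.
by rewrite coef_deriv z // mul0rn.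
Qed.

Lemma derivn_pos q m d : (m <= d)%N -> (forall j, (m <= j)%N -> 0 <= q`_j) ->
  0 < q`_d -> forall t, 0 < t -> 0 < q^`(m).[t].
Proof.
move=> md nn qd t t0.
have c i : 0 <= q^`(m)`_i by rewrite coef_derivn mulrn_wge0 // nn // leq_addr.
have cd : 0 < q^`(m)`_(d - m).
  by rewrite coef_derivn subnKC // pmulrn_rgt0 // ffact_gt0.
have ds : (d - m < size q^`(m))%N.
  by rewrite ltnNge; apply/negP => /leq_sizeP/(_ _ (leqnn _)) h; move: cd; rewrite h ltxx.
rewrite horner_coef (bigD1 (Ordinal ds)) //= ltr_pwDl //.
  by rewrite mulr_gt0 // exprn_gt0.
by apply: sumr_ge0 => i _; rewrite mulr_ge0 // exprn_ge0 // ltW.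
Qed.

(** Near 0, [g] is of order t^m, whereas f(t) >= f_j t^j because the coefficients are nonnegative;
    for j < m domination forces f_j = 0. *)
Lemma dominated_low_coef f g m : (forall i, 0 <= f`_i) ->
  (forall t, 0 < t -> f.[t] <= g.[t]) -> (forall j, (j < m)%N -> g`_j = 0) ->
  forall j, (j < m)%N -> f`_j = 0.
Proof.
move=> nn le gz j jm; apply/eqP; rewrite eq_le nn andbT leNgt; apply/negP => fj.
have gE : g = drop_poly m g * 'X^m.
  rewrite -{1}[g](poly_take_drop m) [take_poly m g](_ : _ = 0) ?add0r //.
  by apply/polyP => i; rewrite coef_take_poly coef0; case: ifP => // /gz.
have [C hC] := poly_disk_bound (drop_poly m g) 1.
have C0 : 0 <= C by apply: le_trans (hC 0 _); rewrite ?normr0.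
(* Chosen so that t <= 1 and C t < f_j, hence C t^(j+1) < f_j t^j. *)
pose t := f`_j / (C + f`_j + 1).
have D0 : 0 < C + f`_j + 1 by lra.
have t0 : 0 < t by rewrite divr_gt0.
have t1 : t <= 1 by rewrite ler_pdivrMr // mul1r; lra.
have Ct : C * t < f`_j.
  by rewrite mulrA ltr_pdivrMr // mulrC ltr_pM2l //; lra.
have js : (j < size f)%N.
  by rewrite ltnNge; apply/negP => /leq_sizeP/(_ _ (leqnn _)) h; move: fj; rewrite h ltxx.
have ft : f`_j * t ^+ j <= f.[t].
  rewrite horner_coef (bigD1 (Ordinal js)) //= lerDl sumr_ge0 // => i _.
  by rewrite mulr_ge0 // exprn_ge0 // ltW.
have gt : g.[t] <= C * t ^+ j.+1.
  rewrite gE hornerM hornerXn; apply: (@le_trans _ _ (C * t ^+ m)).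
    rewrite ler_wpM2r ?exprn_ge0 ?(ltW t0) //.
    by apply: le_trans (ler_norm _) (hC _ _); rewrite ger0_norm // ltW.
  by rewrite ler_wpM2l // ler_wiXn2l // ltW.
have := le_trans ft (le_trans (le t t0) gt).
by rewrite exprS mulrA ler_pM2r ?exprn_gt0 // leNgt Ct.
Qed.

Lemma coef_comp_polyN q i : (q \Po (- 'X))`_i = (-1) ^+ i * q`_i.
Proof.
elim/poly_ind: q i => [|q c IH] i; first by rewrite comp_poly0 !coef0 mulr0.
rewrite comp_polyD comp_polyM comp_polyX comp_polyC mulrN !coefD coefN !coefMX !coefC.
case: i => [|i] /=; first by rewrite oppr0 !add0r expr0 mul1r.
by rewrite !addr0 IH exprS mulN1r mulNr.
Qed.

Lemma derivn_comp_polyN q m : (q \Po (- 'X))^`(m) = (-1) ^+ m *: (q^`(m) \Po (- 'X)).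
Proof.
elim: m => [|m IH]; first by rewrite !derivn0 scale1r.
rewrite derivnS IH derivZ deriv_comp derivN derivX mulrN1 -derivnS.
by rewrite scalerN -scaleNr exprS mulN1r.
Qed.

Lemma derivn_comp_shift q (c : R) m : (q \Po ('X + c%:P))^`(m) = q^`(m) \Po ('X + c%:P).
Proof.
elim: m => [|m IH]; first by rewrite !derivn0.
by rewrite derivnS IH deriv_comp derivD derivX derivC addr0 mulr1 -derivnS.
Qed.

Lemma mup0_coef q (m := mup 0 q) : q != 0 ->
  (forall j, (j < m)%N -> q`_j = 0) /\ q`_m != 0.
Proof.
move=> q0; have dvdE k : ('X^k %| q) <-> (forall j, (j < k)%N -> q`_j = 0).
  split=> [/dvdpP[h ->] j jk|z]; first by rewrite coefMXn jk.
  rewrite -[q](poly_take_drop k) [take_poly k q](_ : _ = 0) ?add0r ?dvdp_mull //.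
  by apply/polyP => i; rewrite coef_take_poly coef0; case: ifP => // /z.
have leE k : (k <= m)%N = ('X^k %| q) by rewrite /m mup_geq // subr0.
have low : forall j, (j < m)%N -> q`_j = 0 by apply/dvdE; rewrite -leE.
split=> //; apply/negP => /eqP qm.
have : (m.+1 <= m)%N; last by rewrite ltnn.
rewrite leE; apply/dvdE => j; rewrite ltnS leq_eqVlt => /orP[/eqP->//|]; exact: low.
Qed.

End Univariate.

(** * Hyperbolicity cones and derivative relaxations *)

Section HyperbolicCone.
Context {R : realType} {n d : nat}.
Variables (p : mpoly n R) (e : 'rV[R]_n).
Hypotheses (hp : p \is @ishomog1 n R d mdeg) (hyp : hyperbolic p e).
Implicit Types (a b x y : 'rV[R]_n).

Lemma on_line_lead x : size (on_line p x e) = d.+1 /\ lead_coef (on_line p x e) = peval p e.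
Proof.
have [pe _] := hyp.
have top : (on_line p x e)`_d != 0 by rewrite (coef_on_line_top x e hp) gt_eqF.
have [-> ->] := lead_coef_bounded (size_on_line x e hp) top.
by rewrite (coef_on_line_top x e hp).
Qed.

(** Homogeneity with the factor -1. It trades the [- x] in the definitions of the cone and of the
    multiplicity for f_x, reversing the sign of the zeros. *)
Lemma on_lineN x : on_line p (- x) e = (-1) ^+ d *: (on_line p x e \Po (- 'X)).
Proof.
rewrite /on_line -/(comp_poly (- 'X) _) rmorph_mmap /=.
rewrite -mul_polyC rmorphXn /= -(mmap_scale _ _ _ hp); apply: eq_mmap => i /=.
  by rewrite comp_polyC.
rewrite comp_polyD comp_polyC comp_polyZ comp_polyX mxE.
by rewrite !polyCN polyC1 scalerN mulN1r opprD opprK.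
Qed.

Lemma on_line_shift x (t : R) : on_line p (x + t *: e) e = on_line p x e \Po ('X + t%:P).
Proof.
rewrite /on_line -/(comp_poly ('X + t%:P) _) rmorph_mmap /=; apply: eq_mmap => i /=.
  by rewrite comp_polyC.
rewrite comp_polyD comp_polyC comp_polyZ comp_polyX !mxE.
rewrite scalerDr polyCD -addrA -[_ *: t%:P]mul_polyC -polyCM [t * _]mulrC.
by rewrite [_%:P + e ord0 i *: 'X]addrC.
Qed.

Lemma root_on_lineN x (t : R) : root (on_line p (- x) e) t = root (on_line p x e) (- t).
Proof.
by rewrite /root on_lineN hornerZ mulf_eq0 signr_eq0 horner_comp hornerN hornerX.
Qed.

Lemma hyperbolicity_coneP x :
  hyperbolicity_cone p e x <-> forall t, 0 < t -> 0 < (on_line p x e).[t].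
Proof.
have [_ lc] := on_line_lead x; have [pe _] := hyp.
split=> [cx|pos t].
  apply: pos_on_halfline; first by rewrite lc.
  move=> t t0; apply/negP => rt; have := cx (- t).
  by rewrite root_on_lineN opprK => /(_ rt); rewrite oppr_ge0 leNgt t0.
rewrite root_on_lineN leNgt => rt; apply/negP => t0.
by have := pos (- t); rewrite oppr_gt0 t0 (rootP rt) ltxx => /(_ isT).
Qed.

(** On the cone, f_x is p(e) times a product of factors X - r with r <= 0. *)
Lemma hyperbolicity_cone_coef x : hyperbolicity_cone p e x ->
  (forall i, 0 <= (on_line p x e)`_i) /\
  (forall i j, (i <= j <= d)%N -> 0 < (on_line p x e)`_i -> 0 < (on_line p x e)`_j).
Proof.
move=> /hyperbolicity_coneP pos; have [sz lc] := on_line_lead x.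
have [pe rr] := hyp; have := rr (- x); rewrite opprK => /real_rooted_splits[rs rsE].
have pE i : (on_line p x e)`_i = peval p e * (\prod_(r <- rs) ('X - r%:P))`_i.
  by rewrite rsE lc coefZ.
have sr : size rs = d.
  apply/succn_inj; rewrite -sz rsE lc size_scale ?gt_eqF //.
  by rewrite size_prod_XsubC.
have /prod_nonpos_roots_coef[nn up] : all (fun r => r <= 0) rs.
  apply/allP => r rr'; rewrite leNgt; apply/negP => /pos.
  have : root (on_line p x e) r by rewrite rsE lc rootZ ?gt_eqF // root_prod_XsubC.
  by move=> /rootP ->; rewrite ltxx.
split=> [i|i j]; first by rewrite pE mulr_ge0 // ltW.
by rewrite !pE !pmulr_rgt0 // -{1}sr; apply: up.
Qed.

(** The leading coefficient of f_x^(m) is positive, so having no positive zero amounts to being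
    positive for t > 0. *)
Lemma derivative_relaxationP m x : (m <= d)%N ->
  derivative_relaxation d m p e x <->
  forall t, 0 < t -> 0 < (on_line p x e)^`(m).[t].
Proof.
move=> md; have [sz lc] := on_line_lead x; have [pe _] := hyp.
set f := on_line p x e in sz lc *.
have fd : 0 < f`_d by rewrite (coef_on_line_top x e hp).
have cd : 0 < f^`(m)`_(d - m).
  by rewrite coef_derivn subnKC // pmulrn_rgt0 // ffact_gt0.
have sm : (size f^`(m) <= (d - m).+1)%N.
  apply/leq_sizeP => j jd; rewrite coef_derivn nth_default ?mul0rn //.
  by rewrite sz -ltn_subLR // -subSn // subSn.
have [_ lm] := lead_coef_bounded sm (lt0r_neq0 cd).
rewrite /derivative_relaxation.
have [mlt|dm] := ltnP m d; last first.
  (* For m = d the derivative is a positive constant, in agreement with the convention that the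
     relaxation is the whole space. *)
  have mE : m = d by apply/eqP; rewrite eqn_leq md dm.
  split=> // _ t _; move: sm cd; rewrite mE subnn => /size1_polyC ->.
  by rewrite hornerC coefC.
(* D_e^m p(-x + t e) is the m-th derivative of f_(-x) at [t], which is f_x^(m)(-t) up to sign. *)
have rootE t : root (on_line (dirderiv e m p) (- x) e) t = root f^`(m) (- t).
  rewrite /root on_lineE peval_dirderiv on_line_shift derivn_comp_shift horner_comp.
  rewrite hornerD hornerX hornerC add0r on_lineN derivnZ derivn_comp_polyN.
  by rewrite !hornerZ !mulf_eq0 !signr_eq0 /= horner_comp hornerN hornerX.
split=> [cx|pos t].
  apply: pos_on_halfline; first by rewrite lm.
  move=> t t0; apply/negP => rt; have := cx (- t).
  by rewrite rootE opprK => /(_ rt); rewrite oppr_ge0 leNgt t0.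
rewrite rootE leNgt => rt; apply/negP => t0.
by have := pos (- t); rewrite oppr_gt0 t0 (rootP rt) ltxx => /(_ isT).
Qed.

Lemma hyperbolicity_cone_scale (c : R) x : 0 <= c ->
  hyperbolicity_cone p e x -> hyperbolicity_cone p e (c *: x).
Proof.
rewrite le_eqVlt => /orP[/eqP<- _|c0 /hyperbolicity_coneP pos];
  apply/hyperbolicity_coneP => t t0; rewrite on_lineE.
  rewrite scale0r add0r (peval_scale t e hp) mulr_gt0 ?exprn_gt0 //.
  by have [] := hyp.
have -> : c *: x + t *: e = c *: (x + (t / c) *: e).
  by rewrite scalerDr scalerA mulrCA divff ?mulr1 // gt_eqF.
rewrite (peval_scale c _ hp) mulr_gt0 ?exprn_gt0 // -on_lineE pos //.
by rewrite divr_gt0.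
Qed.

(* Along the direction [a + t e], for which [p] is again hyperbolic, the zeros of
   [s |-> p (b + s (a + t e))] are nonpositive, so the value at [s = 1] is at
   least the leading coefficient. *)
Lemma hyperbolic_monotone a b :
  (forall s : R, 0 <= s -> hyperbolicity_cone p e (a + s *: b)) ->
  forall t, 0 < t -> (on_line p a e).[t] <= (on_line p (a + b) e).[t].
Proof.
move=> cab t t0; have [x xE] : exists x, x = a + t *: e by eexists.
have pos s t' : 0 <= s -> 0 < t' -> 0 < peval p (a + s *: b + t' *: e).
  by move=> /cab/hyperbolicity_coneP h /h; rewrite on_lineE.
have xpos t' : 0 <= t' -> 0 < peval p (x + t' *: e).
  move=> t'0; rewrite xE -addrA -scalerDl -[a](addr0 a) -(scale0r b).
  by rewrite pos // ltr_pwDl.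
have px : 0 < peval p x by have := xpos 0 (lexx _); rewrite scale0r addr0.
have rr : real_rooted (on_line p b x) by apply: hyperbolic_direction hp hyp xpos _.
have [rs rsE] := real_rooted_splits rr.
have lc : lead_coef (on_line p b x) = peval p x.
  have top : (on_line p b x)`_d != 0 by rewrite (coef_on_line_top b x hp) gt_eqF.
  have [_ ->] := lead_coef_bounded (size_on_line b x hp) top.
  by rewrite (coef_on_line_top b x hp).
have rs0 : all (fun r => r <= 0) rs.
  apply/allP => r rrs; rewrite leNgt; apply/negP => r0.
  have : root (on_line p b x) r by rewrite rsE lc rootZ ?gt_eqF // root_prod_XsubC.
  rewrite /root on_lineE.
  (* By homogeneity a zero r > 0 would make [p] vanish at a + b/r + t e, although a + b/r lies in
     the cone. *)
  have -> : b + r *: x = r *: (a + r^-1 *: b + t *: e).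
    by rewrite addrAC -xE scalerDr scalerA divff ?gt_eqF // scale1r addrC.
  rewrite (peval_scale r _ hp) mulf_eq0 => /orP[|]; first by rewrite expf_eq0 gt_eqF ?andbF.
  by rewrite gt_eqF // pos // invr_ge0 ltW.
have -> : (on_line p (a + b) e).[t] = (on_line p b x).[1].
  by rewrite !on_lineE scale1r xE addrAC addrC.
rewrite on_lineE -xE rsE lc hornerZ horner_prod ler_peMr ?(ltW px) //.
elim: rs rs0 {rsE} => [|r rs IH] /=; first by rewrite big_nil.
move=> /andP[r0 /IH h]; rewrite big_cons mulr_ege1 //.
by rewrite hornerXsubC lerDl oppr_ge0.
Qed.

(** Exhibits coefficient [k] of f_x as the polynomial D_e^k p(x) / k! in [x], which gives its
    continuity and its vanishing along lines. *)
Lemma coef_on_line_dirderiv x k :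
  peval (dirderiv e k p) x = (on_line p x e)`_k * (k`!)%:R.
Proof. by rewrite peval_dirderiv horner_coef0 coef_derivn addn0 ffactnn mulr_natr. Qed.

Lemma coef_on_line_scale (c : R) x k : c != 0 ->
  (on_line p (c *: x) e)`_k = 0 -> (on_line p x e)`_k = 0.
Proof.
move=> c0; have -> : on_line p (c *: x) e = c ^+ d *: (on_line p x e \Po (c^-1 *: 'X)).
  rewrite /on_line -/(comp_poly (c^-1 *: 'X) _) rmorph_mmap /=.
  rewrite -mul_polyC rmorphXn /= -(mmap_scale _ _ _ hp); apply: eq_mmap => i /=.
    by rewrite comp_polyC.
  rewrite comp_polyD comp_polyC comp_polyZ comp_polyX mxE.
  by rewrite mulrDr -polyCM !mul_polyC !scalerA mulrAC divff // mul1r.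
rewrite coefZ => /eqP; rewrite mulf_eq0 expf_eq0 (negPf c0) andbF /=.
have -> : (on_line p x e \Po (c^-1 *: 'X))`_k = c^-1 ^+ k * (on_line p x e)`_k.
  elim/poly_ind: (on_line p x e) k => [|q a IH] k; first by rewrite comp_poly0 !coef0 mulr0.
  rewrite comp_polyD comp_polyM comp_polyX comp_polyC -scalerAr !coefD coefZ !coefMX !coefC.
  case: k => [|k] /=; first by rewrite mulr0 !add0r expr0 mul1r.
  by rewrite !addr0 IH exprS mulrA.
by rewrite mulf_eq0 expf_eq0 invr_eq0 (negPf c0) andbF => /eqP.
Qed.

Lemma pmult_coef z (m := pmult p e z) :
  [/\ (m <= d)%N, forall j, (j < m)%N -> (on_line p z e)`_j = 0
    & (on_line p z e)`_m != 0].
Proof.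
have [sz _] := on_line_lead (- z); have [pe _] := hyp.
have q0 : on_line p (- z) e != 0 by rewrite -size_poly_eq0 sz.
have cE j : ((on_line p (- z) e)`_j == 0) = ((on_line p z e)`_j == 0).
  by rewrite on_lineN coefZ coef_comp_polyN !mulf_eq0 !signr_eq0.
have [low top] := mup0_coef q0; split=> [|j /low/eqP|].
- rewrite leqNgt; apply/negP => /low.
  by rewrite (coef_on_line_top _ _ hp) => /eqP; rewrite gt_eqF.
- by rewrite cE => /eqP.
- by rewrite -cE.
Qed.

Lemma continuous_peval (q : mpoly n R) : continuous (peval q : 'rV[R]_n -> R).
Proof.
have mon (m : multinom n) : continuous (fun x : 'rV[R]_n => \prod_(i < n) x ord0 i ^+ m i).
  apply: (@continuous_big R _ *%R 1 xpredT (@mul_continuous R) _ _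
    (fun i (x : 'rV[R]_n) => x ord0 i ^+ m i)) => i _ x.
  apply: (@continuous_comp _ _ _ (fun x : 'rV[R]_n => x ord0 i)
    (fun u : R => u ^+ m i)); first exact: coord_continuous.
  exact: exprn_continuous.
rewrite (_ : peval q = fun x : 'rV[R]_n =>
  \sum_(m <- msupp q) mcoeff m q * \prod_(i < n) x ord0 i ^+ m i) //.
refine (@continuous_big R _ +%R 0 xpredT _ _ (msupp q)
  (fun m (x : 'rV[R]_n) => mcoeff m q * \prod_(i < n) x ord0 i ^+ m i) _).
  exact: add_continuous.
move=> m _ x.
by apply: continuousM; [apply: cst_continuous | exact: mon].
Qed.

Lemma coef_on_line_near z k : 0 < (on_line p z e)`_k ->
  \forall y \near z, 0 < (on_line p y e)`_k.
Proof.
move=> ck; have : 0 < peval (dirderiv e k p) z.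
  by rewrite coef_on_line_dirderiv mulr_gt0 // ltr0n fact_gt0.
move=> /(cvgr_gt _ (continuous_peval (q := _) (x := z))).
apply: filterS => y; rewrite coef_on_line_dirderiv pmulr_lgt0 // ltr0n fact_gt0.
Qed.

End HyperbolicCone.

(** * Faces *)

Section Faces.
Context {R : realType} {n : nat}.
Implicit Types (C F : set 'rV[R]_n) (x y z v : 'rV[R]_n).

Lemma convex_setP F x y (t : R) : @convex_set R 'rV[R]_n F -> F x -> F y ->
  0 <= t -> t <= 1 -> F (t *: x + (1 - t) *: y).
Proof.
move=> cF Fx Fy t0 t1; have := cF x y (Itv01 t0 t1).
by rewrite !in_setE => /(_ Fx Fy).
Qed.

(** For c > 1 the point [x] is a proper convex combination of 0 and c x, so the face property yields
    both; sums are doubled midpoints. *)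
Lemma face_cone F C z : (forall (c : R) x, 0 <= c -> C x -> C (c *: x)) ->
  is_face F C -> F z ->
  [/\ F 0, forall (c : R) x, 0 <= c -> F x -> F (c *: x)
    & forall x y, F x -> F y -> F (x + y)].
Proof.
move=> cC [_ cF FC face] Fz.
have F2 x : F x -> F 0 /\ F (2 *: x).
  move=> Fx; have Cx := FC x Fx.
  apply: (face _ _ (1 / 2)).
  - by rewrite -(scale0r x); apply: cC.
  - exact: cC.
  - by lra.
  - by lra.
  - by rewrite scaler0 add0r scalerA (_ : _ * 2 = 1) ?scale1r //; lra.
have F0 : F 0 by have [] := F2 z Fz.
have Fs (c : R) x : 0 <= c -> F x -> F (c *: x).
  move=> c0 Fx; have [c1|c1] := leP c 1.
    by have := convex_setP cF Fx F0 c0 c1; rewrite scaler0 addr0.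
  have cp : 0 < c by lra.
  suff [] : F (c *: x) /\ F 0 by [].
  apply: (face _ _ c^-1).
  - exact/cC/FC.
  - exact: FC.
  - by rewrite invr_gt0.
  - by rewrite invf_lt1.
  - by rewrite scaler0 addr0 scalerA mulVf ?scale1r // gt_eqF.
split=> // x y Fx Fy.
have h0 : (0 : R) <= 1 / 2 by lra.
have h1 : (1 / 2 : R) <= 1 by lra.
have := Fs 2 _ (ler0n _ 2) (convex_setP cF Fx Fy h0 h1).
rewrite scalerDr !scalerA (_ : 2 * (1 / 2) = 1); last by lra.
by rewrite (_ : 2 * (1 - 1 / 2) = 1) ?scale1r //; lra.
Qed.

Lemma sub_linear_span F : F `<=` linear_span F.
Proof.
move=> x Fx; exists 1%N, (fun=> 1), (fun=> x); split=> //.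
by rewrite big_ord_recl big_ord0 scale1r addr0.
Qed.

Lemma linear_spanD F x y : linear_span F x -> linear_span F y -> linear_span F (x + y).
Proof.
move=> [k [c [v [Fv ->]]]] [l [b [w [Fw ->]]]].
exists (k + l)%N,
  (fun i => match fintype.split i with inl j => c j | inr j => b j end),
  (fun i => match fintype.split i with inl j => v j | inr j => w j end).
split=> [i|]; first by case: fintype.split.
rewrite big_split_ord /=; congr (_ + _); apply: eq_bigr => i _.
  by rewrite (unsplitK (inl _ i)).
by rewrite (unsplitK (inr _ i)).
Qed.

Lemma linear_spanZ F (a : R) x : linear_span F x -> linear_span F (a *: x).
Proof.
move=> [k [c [v [Fv ->]]]]; exists k, (fun i => a * c i), v; split=> //.
by rewrite scaler_sumr; apply: eq_bigr => i _; rewrite scalerA.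
Qed.

(** The origin takes up the missing weight 1 - sum c_j. Thus the relative interior, defined through
    the affine span, can be used along all directions of the linear span. *)
Lemma linear_span_affine F : F 0 -> linear_span F `<=` affine_span F.
Proof.
move=> F0 x [k [c [v [Fv ->]]]].
exists k.+1, (fun i => if unlift ord0 i is Some j then c j else 1 - \sum_(j < k) c j),
  (fun i => if unlift ord0 i is Some j then v j else 0).
split=> [i||]; first by case: unlift.
  rewrite big_ord_recl unlift_none -[RHS](subrK (\sum_(j < k) c j)).
  by congr (_ + _); apply: eq_bigr => i _; rewrite liftK.
rewrite big_ord_recl unlift_none scaler0 add0r; apply: eq_bigr => i _.
by rewrite !liftK.
Qed.

Lemma relative_interior_perturb F z x : F 0 -> relative_interior F z ->
  linear_span F x ->
  exists2 dl : R, 0 < dl & forall s, `|s| <= dl -> F (z + s *: x).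
Proof.
move=> F0 [Fz /nbhs_normP[eps /= eps0 near]] sx.
have D0 : 0 < `|x| + 1 by rewrite ltr_wpDl.
(* The added 1 keeps the denominator positive when x = 0 and makes |s x| < eps strict. *)
exists (eps / (`|x| + 1)) => [|s ss]; first by rewrite divr_gt0.
apply: near; last first.
  apply: linear_span_affine => //; apply: linear_spanD; last exact: linear_spanZ.
  exact: sub_linear_span.
rewrite /= opprD addNKr normrN normrZ.
apply: (@le_lt_trans _ _ (eps / (`|x| + 1) * `|x|)); first by rewrite ler_wpM2r.
by rewrite mulrAC ltr_pdivrMr // ltr_pM2l // ltrDl.
Qed.

(** Moving from [x] to [z] and slightly beyond ends at a point [y] of [F]; then [z] is a proper
    convex combination of [x] and [y], and the face property applies. *)
Lemma face_of_span F C z x : is_face F C -> F 0 -> relative_interior F z ->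
  C x -> linear_span F x -> F x.
Proof.
move=> [cl cF FC face] F0 ri Cx sx; have [Fz _] := ri.
have [|dl dl0 h] := @relative_interior_perturb F z (z - x) F0 ri.
  apply: linear_spanD; first exact: sub_linear_span.
  by rewrite -scaleN1r; apply: linear_spanZ.
pose y := z + dl *: (z - x).
have Fy : F y by apply: h; rewrite ger0_norm // ltW.
have D0 : 0 < 1 + dl by rewrite ltr_pwDl // ltW.
have a1 : dl / (1 + dl) < 1 by rewrite ltr_pdivrMr // mul1r ltrDr.
suff [] : F x /\ F y by [].
(* The weights come from z = (dl x + y) / (1 + dl). *)
apply: (face _ _ (dl / (1 + dl)) Cx (FC _ Fy) (divr_gt0 dl0 D0) a1).
have -> : 1 - dl / (1 + dl) = (1 + dl)^-1.
  by field; rewrite gt_eqF.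
rewrite mulrC -scalerA -scalerDr.
have -> : dl *: x + y = (1 + dl) *: z.
  by rewrite /y scalerBr addrCA [dl *: x + _]addrC subrK scalerDl scale1r.
by rewrite scalerA mulVf ?scale1r // gt_eqF.
Qed.

End Faces.

(** * Vanishing of the low coefficients on the span of a face *)

Section FaceMultiplicity.
Context {R : realType} {n d : nat}.
Variables (p : mpoly n R) (e : 'rV[R]_n) (F : set 'rV[R]_n) (z : 'rV[R]_n).
Hypotheses (hp : p \is @ishomog1 n R d mdeg) (hyp : hyperbolic p e).
Hypotheses (face_F : is_face F (hyperbolicity_cone p e)) (ri_z : relative_interior F z).
Let m := pmult p e z.

(** With z = dl x + b and both summands in [F], f_(dl x) is dominated by f_z, which vanishes to
    order [m] at 0. *)
Lemma coef_face_low x j : F x -> (j < m)%N -> (on_line p x e)`_j = 0.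
Proof.
move=> Fx jm; have [_ _ FC _] := face_F; have [Fz _] := ri_z.
have [F0 Fs FD] := face_cone (hyperbolicity_cone_scale hp hyp) face_F Fz.
have [dl dl0 h] := relative_interior_perturb F0 ri_z (sub_linear_span Fx).
have [_ zlow _] := pmult_coef hp hyp z.
apply: (coef_on_line_scale hp (lt0r_neq0 dl0)).
pose b := z + (- dl) *: x.
have Fb : F b by apply: h; rewrite normrN ger0_norm // ltW.
have Fa : F (dl *: x) by apply: Fs => //; exact: ltW.
have [nn _] := hyperbolicity_cone_coef hp hyp (FC _ Fa).
apply: (@dominated_low_coef _ _ (on_line p z e) m) => // t t0.
have -> : z = dl *: x + b by rewrite /b scaleNr addrC subrK.
apply: (hyperbolic_monotone hp hyp) => // s s0.
by apply: FC; apply: FD => //; apply: Fs.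
Qed.

(** Along x + t z, coefficient [j] is a polynomial in [t]. For t >= 1/dl the point t (z + x/t) lies
    in [F], so this polynomial vanishes for large [t], hence identically, and in particular at t =
    0. *)
Lemma coef_span_low x j : linear_span F x -> (j < m)%N -> (on_line p x e)`_j = 0.
Proof.
move=> sx jm; have [Fz _] := ri_z.
have [F0 Fs FD] := face_cone (hyperbolicity_cone_scale hp hyp) face_F Fz.
have [dl dl0 h] := relative_interior_perturb F0 ri_z sx.
have fact0 : (j`!)%:R != 0 :> R by rewrite pnatr_eq0 -lt0n fact_gt0.
suff q0 : on_line (dirderiv e j p) x z = 0.
  have : (on_line (dirderiv e j p) x z).[0] = 0 by rewrite q0 horner0.
  rewrite on_lineE scale0r addr0 coef_on_line_dirderiv => /eqP.
  by rewrite mulf_eq0 (negPf fact0) orbF => /eqP.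
apply: (@zero_at_infinity _ _ dl^-1) => t tdl.
have t0 : 0 < t by apply: lt_le_trans tdl; rewrite invr_gt0.
rewrite on_lineE coef_on_line_dirderiv coef_face_low ?mul0r //.
have -> : x + t *: z = t *: (z + t^-1 *: x).
  by rewrite scalerDr scalerA divff ?gt_eqF // scale1r addrC.
apply: Fs; first exact: ltW.
by apply: h; rewrite ger0_norm ?invr_ge0 ?(ltW t0) // invf_ple ?posrE.
Qed.

End FaceMultiplicity.

Theorem proposition3p3 (R : realType) (n d : nat) (p : mpoly n R)
    (e : 'rV[R]_n) (F : set 'rV[R]_n) (z : 'rV[R]_n)
    (hom_p : p \is @ishomog1 n R d mdeg)
    (hyp_p : hyperbolic p e)
    (face_F : is_face F (hyperbolicity_cone p e))
    (ri_z : relative_interior F z) :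
  let m := pmult p e z in
  (derivative_relaxation d m p e)° z /\
  F = linear_span F `&` derivative_relaxation d m p e.
Proof.
move=> m; have [cl _ FC _] := face_F; have [Fz _] := ri_z.
have [F0 _ _] := face_cone (hyperbolicity_cone_scale hom_p hyp_p) face_F Fz.
have [md _ zm] := pmult_coef hom_p hyp_p z; rewrite -/m in md zm.
have lead x : 0 < (on_line p x e)`_d.
  by rewrite (coef_on_line_top x e hom_p); have [] := hyp_p.
have [nn up] := hyperbolicity_cone_coef hom_p hyp_p (FC z Fz).
split.
  (* Finitely many indices are involved, so the neighbourhoods for the single coefficients can be
     intersected. *)
  have pos : \forall y \near z, forall j : 'I_d.+1, (m <= j)%N -> 0 < (on_line p y e)`_j.
    refine (@filter_forall _ _ (fun (j : 'I_d.+1) y => (m <= j)%N -> 0 < (on_line p y e)`_j)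
      (nbhs z) _ _) => j.
    have [mj|jm] := leqP m j; last first.
      by apply: nearW.
    (* Coefficient [m] of f_z is nonzero by the choice of [m] and nonnegative since [z] is in the
       cone; its positivity propagates to all indices up to [d]. *)
    have cj : 0 < (on_line p z e)`_j.
      by apply: (up m j); [rewrite mj -ltnS ltn_ord | rewrite lt_neqAle eq_sym zm nn].
    by apply: filterS (coef_on_line_near cj) => y.
  apply: filterS pos => y pos; apply/(derivative_relaxationP hom_p hyp_p _ md).
  apply: (derivn_pos md) (lead y) => j mj; have [jd|dj] := ltnP j d.+1.
    exact/ltW/(pos (Ordinal jd)).
  by rewrite nth_default // (leq_trans (size_on_line y e hom_p)).
apply/seteqP; split=> [x Fx|x [sx rx]].
  split; first exact: sub_linear_span.
  apply/(derivative_relaxationP hom_p hyp_p _ md); apply: (derivn_pos md) (lead x) => j _.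
  by have [h _] := hyperbolicity_cone_coef hom_p hyp_p (FC x Fx).
(* It remains to place [x] in the cone: the low coefficients vanish on the span, so f_x^(m) > 0
   integrates to f_x > 0. *)
apply: (face_of_span face_F F0 ri_z) => //.
apply/(hyperbolicity_coneP hom_p hyp_p); apply: (@pos_of_derivn_pos _ _ m).
  by move=> j; apply: (coef_span_low hom_p hyp_p face_F ri_z).
exact/(derivative_relaxationP hom_p hyp_p).
Qed.
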